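(* Let $\theta\in\mathbb{R}\setminus\mathbb{Q}$. For real $t\ge 1$ let $$\Lambda(t)=\left\{\left((m\theta-n)\sqrt{t},\ \frac{m}{\sqrt{t}}\right)\ \middle|\ m,n\in\mathbb{Z}\right\}\subset\mathbb{R}^2 .$$ Then the following conditions are mutually equivalent: (i) The family $\{\Lambda(t)\}_{t\ge 1}$ is relatively dense. (ii) The family $\{\Lambda(t)\}_{t\ge 1}$ is uniformly discrete. (iii) $\theta$ is badly approximable.
   Context: $B(\zeta,r)$ denotes the open Euclidean disk of center $\zeta$ and radius $r$ in $\mathbb{R}^2$. Let $T\subset\mathbb{R}$ be a parameter set. A family of point sets $\{\Lambda_t\subset\mathbb{R}^2\mid t\in T\}$ is called relatively dense if there exists $r>0$ such that for any $t\in T$ and any $\zeta\in\mathbb{R}^2$ we have $B(\zeta,r)\cap\Lambda_t\ne\emptyset$. The family is called uniformly discrete if there exists $s>0$ such that for any $t\in T$ and any $\zeta\in\mathbb{R}^2$ we have $\#(B(\zeta,s)\cap\Lambda_t)\le 1$. Here $T=\{t\in\mathbb{R}\mid t\ge 1\}$. An irrational $\theta$ is called badly approximable if the set of partial quotients $\{a_i\mid i\ge 0\}$ of its continued fraction expansion $\theta=[a_0,a_1,a_2,\dots]$ ($a_0\in\mathbb{Z}$, $a_i\in\mathbb{Z}_{>0}$ for $i\ge 1$) is bounded. *)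

(* Defs.v *)
From mathcomp Require Import all_boot all_order all_algebra.
From mathcomp Require Import all_classical all_reals.

Set Implicit Arguments.
Unset Strict Implicit.
Unset Printing Implicit Defensive.

Import Order.TTheory GRing.Theory Num.Theory.

Local Open Scope classical_set_scope.
Local Open Scope ring_scope.

(* The disk is Euclidean, unlike the library's [ball] on [R * R], which is
   taken for the sup norm. *)
Definition disk (R : realType) (z : R * R) (r : R) : set (R * R) :=
  [set p | Num.sqrt ((p.1 - z.1) ^+ 2 + (p.2 - z.2) ^+ 2) < r].

Definition relatively_dense (R : realType) (T : set R)
    (L : R -> set (R * R)) : Prop :=
  exists2 r : R, 0 < r &
    forall t, T t -> forall z : R * R, disk z r `&` L t !=set0.

Definition uniformly_discrete (R : realType) (T : set R)
    (L : R -> set (R * R)) : Prop :=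
  exists2 s : R, 0 < s &
    forall t, T t -> forall z : R * R, (disk z s `&` L t #<= `I_1)%card.

Definition Lambda (R : realType) (theta t : R) : set (R * R) :=
  [set p | exists m n : int,
     p = ((m%:~R * theta - n%:~R) * Num.sqrt t, m%:~R / Num.sqrt t)].

(* [theta = [a_0, a_1, ..., a_(i-1), x_i]] with [x_i] the complete quotient:
   [x_0 = theta] and [x_(i+1) = 1 / (x_i - floor x_i)].  For irrational [theta]
   no denominator vanishes and the expansion does not terminate. *)
Definition complete_quotient (R : realType) (theta : R) (i : nat) : R :=
  iter i (fun x : R => (x - (Num.floor x)%:~R)^-1) theta.

Definition partial_quotient (R : realType) (theta : R) (i : nat) : int :=
  Num.floor (complete_quotient theta i).

Definition badly_approximable (R : realType) (theta : R) : Prop :=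
  irrational theta /\
  exists M : int, forall i : nat, `|partial_quotient theta i| <= M.

(* Main.v *)
Require Import Defs.
From mathcomp Require Import all_boot all_order all_algebra.
From mathcomp Require Import all_classical all_reals.
From mathcomp Require Import ring lra zify.

Set Implicit Arguments.
Unset Strict Implicit.
Unset Printing Implicit Defensive.

Import Order.TTheory GRing.Theory Num.Theory.

Local Open Scope classical_set_scope.
Local Open Scope ring_scope.

(** Everything goes through one inequality: theta is badly approximable iff
    [|m| |m theta - n|] stays away from zero for integers [m != 0] and [n]
    ([diophantine_gap]).

    The geometry is that of a unimodular lattice.  The product of the two
    coordinates of a point of [Lambda theta t] is [m (m theta - n)] and does not
    depend on [t].  If it is bounded below, then so is the length of the point,
    by the arithmetic-geometric mean inequality; conversely, choosing
    [t = |m| / |m theta - n|] makes the two coordinates equal in size, so that a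
    lower bound on lengths for all [t >= 1] gives one on products
    ([short_vector_diophantine_gap]).  Uniform discreteness is the statement that
    differences of points are not short.  Relative density also forbids short
    vectors: along a short lattice vector [v] the lattice lies on lines parallel
    to [v] at distance [1 / |v|], and a large disk fits between two of them
    ([relatively_dense_short_vector_gap]).

    The arithmetic is that of the convergents [p_k / q_k].  With [x_k] the
    complete quotients, [|q_k theta - p_k| (q_k x_(k+1) + q_(k-1)) = 1]
    ([cf_err_norm]), so [q_k |q_k theta - p_k|] is of the order of
    [1 / a_(k+1)]; and since a convergent beats every fraction whose
    denominator is less than the next one ([cf_err_best]), these values
    control the product for all [m] and [n].

    There remains the passage from bounded partial quotients to relative
    density.  For given [t], the two convergents whose denominators enclose
    [sqrt t] give a basis of [Lambda theta t]; as [q_(k+1) <= (M + 1) q_k],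
    both of its vectors are bounded independently of [t], and every point of the
    plane is at bounded distance from the lattice ([lattice_rounding]). *)

(** * Convergents of the continued fraction *)

(** Indices are shifted by two with respect to the usual convention: index [0]
    stands for [q_(-2) = 1] and [p_(-2) = 0], index [1] for [q_(-1) = 0] and
    [p_(-1) = 1], so that a single recurrence covers the whole expansion and
    [cf_den theta i.+2 = q_i]. *)
Fixpoint three_term (V : pzRingType) (a : nat -> V) (u0 u1 : V) (i : nat) : V :=
  if i is j.+1 then
    if j is k.+1 then a k * three_term a u0 u1 j + three_term a u0 u1 k else u1
  else u0.

Definition cf_den (R : realType) (theta : R) : nat -> int :=
  three_term (partial_quotient theta) 1 0.

Definition cf_num (R : realType) (theta : R) : nat -> int :=
  three_term (partial_quotient theta) 0 1.

Definition cf_err (R : realType) (theta : R) (i : nat) : R :=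
  (cf_den theta i)%:~R * theta - (cf_num theta i)%:~R.

Section Convergents.
Context {R : realType} (theta : R).

Local Notation x := (complete_quotient theta).
Local Notation a := (partial_quotient theta).
Local Notation q := (cf_den theta).
Local Notation p := (cf_num theta).
Local Notation e := (cf_err theta).

Lemma cf_errSS i : e i.+2 = (a i)%:~R * e i.+1 + e i.
Proof.
rewrite /cf_err /cf_den /cf_num /=.
by rewrite !intrD !intrM; ring.
Qed.

Lemma cf_denSS i : q i.+2 = a i * q i.+1 + q i.
Proof. by []. Qed.

Lemma cf_det i : (q i.+1)%:~R * e i - (q i)%:~R * e i.+1 = (-1) ^+ i.
Proof.
elim: i => [|i IHi]; first by rewrite /cf_err /cf_den /cf_num /=; ring.
by rewrite cf_errSS cf_denSS intrD intrM exprS -IHi; ring.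
Qed.

(** Over the integers this says that consecutive convergents form a basis of
    the lattice [Z^2]. *)
Lemma cf_detz i : q i * p i.+1 - q i.+1 * p i = (-1) ^+ i.
Proof.
apply/eqP; rewrite -(eqr_int R) rmorphXn /= rmorphN1 -cf_det /cf_err.
by apply/eqP; rewrite intrB !intrM; ring.
Qed.

Hypothesis irr_theta : irrational theta.

Lemma complete_quotient_nint i (n : int) : x i != n%:~R.
Proof.
suff : irrational (x i).
  move=> irr; apply/eqP => xn; apply: irr; exists n%:~R => //. by rewrite ratr_int.
elim: i => //= i IHi [r _ rE]; apply: IHi; exists (r^-1 + (a i)%:~R) => //.
by rewrite rmorphD fmorphV /= ratr_int rE invrK subrK.
Qed.

Lemma frac_complete_quotient i : 0 < x i - (a i)%:~R < 1.
Proof.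
have := floor_itv (x i); rewrite -/(a i) intrD => /andP[h1 h2].
have := complete_quotient_nint i (a i); lra.
Qed.

Lemma complete_quotientS_gt1 i : 1 < x i.+1.
Proof.
have /andP[h0 h1] := frac_complete_quotient i.
by rewrite /= -/(a i) invf_gt1.
Qed.

Lemma partial_quotientS_ge1 i : 1 <= a i.+1.
Proof. by rewrite /partial_quotient floor_ge_int ltW// complete_quotientS_gt1. Qed.

(** The complete quotient is, up to sign, the ratio of consecutive errors: one
    step of the Gauss map is one step of the recurrence satisfied by the errors.
    In particular, from index 1 on the errors alternate in sign. *)
Lemma cf_errE i : e i = - x i * e i.+1.
Proof.
elim: i => [|i IHi]; first by rewrite /cf_err /cf_den /cf_num /=; ring.
have /andP[h0 h1] := frac_complete_quotient i.
rewrite cf_errSS IHi /= -/(a i); field; lra.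
Qed.

Lemma cf_den_ge0 i : 0 <= q i.
Proof.
suff: 0 <= q i /\ 0 <= q i.+1 by case.
elim: i => [|[|i] [IH0 IH1]]; [by [] | |].
  by rewrite cf_denSS /= mulr0.
split=> //; rewrite cf_denSS; have := partial_quotientS_ge1 i; nia.
Qed.

Lemma cf_den_homo i : q i.+1 <= q i.+2.
Proof.
case: i => [|i]; first exact: (cf_den_ge0 2).
rewrite [leRHS]cf_denSS.
have := partial_quotientS_ge1 i; have := cf_den_ge0 i.+1; have := cf_den_ge0 i.+2; nia.
Qed.

Lemma cf_den_gt0 i : 0 < q i.+2.
Proof.
elim: i => [|i IHi]; first by rewrite cf_denSS /= mulr0.
exact: lt_le_trans IHi (cf_den_homo _).
Qed.

(** From index 2 on each term is at least the sum of the two preceding ones, so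
    the denominators grow at least linearly. *)
Lemma cf_den_ge i : i%:Z <= q i.+2.
Proof.
suff: i%:Z <= q i.+2 /\ i.+1%:Z <= q i.+3 by case.
elim: i => [|i [IH0 IH1]].
  split; first exact: cf_den_ge0.
  rewrite !cf_denSS /= mulr0 add0r mulr1 addr0; exact: partial_quotientS_ge1.
split=> //; rewrite cf_denSS.
have := partial_quotientS_ge1 i.+1; have := cf_den_gt0 i; nia.
Qed.


(** In the determinant of two consecutive convergents, [cf_errE] expresses the
    earlier error by the later one. *)
Lemma cf_err_norm i : `|e i.+2| * ((q i.+2)%:~R * x i.+1 + (q i.+1)%:~R) = 1.
Proof.
have x1 := complete_quotientS_gt1 i.
have q2 : 0 <= (q i.+2)%:~R :> R by rewrite ler0z cf_den_ge0.
have q1 : 0 <= (q i.+1)%:~R :> R by rewrite ler0z cf_den_ge0.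
have f0 : 0 <= (q i.+2)%:~R * x i.+1 + (q i.+1)%:~R by nra.
have det1 : `|(-1) ^+ i.+1| = 1 :> R by rewrite normrX normrN1 expr1n.
rewrite -[X in _ * X](ger0_norm f0) -normrM -[RHS]det1 -cf_det (cf_errE i.+1).
by rewrite -normrN; congr `|_|; ring.
Qed.

Lemma cf_den_err_upper i : (q i.+3)%:~R * `|e i.+2| <= 1.
Proof.
rewrite -[leRHS](cf_err_norm i) cf_denSS intrD intrM.
have fx : (a i.+1)%:~R <= x i.+1 := floor_le _.
have q2 : 0 <= (q i.+2)%:~R :> R by rewrite ler0z cf_den_ge0.
by rewrite mulrC ler_wpM2l// lerD2r mulrC ler_wpM2l.
Qed.

Lemma cf_den_err_lower (M : R) i : (a i.+1)%:~R <= M ->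
  1 <= (M + 2) * ((q i.+2)%:~R * `|e i.+2|).
Proof.
move=> aM; rewrite -[leLHS](cf_err_norm i) mulrCA mulrC mulrA ler_wpM2r//.
have q2 : 0 <= (q i.+2)%:~R :> R by rewrite ler0z cf_den_ge0.
have q12 : (q i.+1)%:~R <= (q i.+2)%:~R :> R by rewrite ler_int cf_den_homo.
have /andP[_ x1] := frac_complete_quotient i.+1.
have xM : x i.+1 <= M + 1 by lra.
have : (q i.+2)%:~R * x i.+1 <= (q i.+2)%:~R * (M + 1) by rewrite ler_wpM2l.
lra.
Qed.

(** In the basis of [Z^2] given by two consecutive convergents, a pair [(m, n)]
    with [|m|] less than the larger denominator has coordinates [u != 0] and [v]
    of opposite signs.  The errors of the two convergents have opposite signs as
    well, so the two contributions to [m theta - n] do not cancel. *)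
Lemma cf_err_best i (m n : int) : m != 0 -> `|m| < q i.+2 ->
  `|e i.+1| <= `|m%:~R * theta - n%:~R|.
Proof.
move=> m0 mq.
have detD : (q i.+1 * p i.+2 - q i.+2 * p i.+1) ^+ 2 = 1 by rewrite cf_detz sqrr_sign.
set D := _ - _ in detD.
(* Cramer's rule, with the determinant D equal to its own inverse. *)
have [u [v [mE nE]]] :
    exists u v, m = u * q i.+1 + v * q i.+2 /\ n = u * p i.+1 + v * p i.+2.
  exists (D * (m * p i.+2 - n * q i.+2)), (D * (n * q i.+1 - m * p i.+1)).
  by split; rewrite -[LHS]mulr1 -detD /D; ring.
have formE : m%:~R * theta - n%:~R = u%:~R * e i.+1 + v%:~R * e i.+2.
  by rewrite mE nE 2!intrD 4!intrM /cf_err; ring.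
have x1 : 0 < x i.+1 by rewrite (lt_trans ltr01) ?complete_quotientS_gt1.
have q1 := cf_den_ge0 i.+1.
have q2 := cf_den_gt0 i.
have u0 : u != 0.
  apply/eqP => u0; move: m0 mq; rewrite mE u0 mul0r add0r mulf_eq0 negb_or.
  rewrite normrM (gtr0_norm q2) => /andP[v0 _].
  have : 1 <= `|v| by lia.
  nia.
have uv : u * v <= 0.
  rewrite leNgt; apply/negP => uv; move: mq; rewrite mE.
  have [u1|u1] : u <= -1 \/ 1 <= u by lia.
    have v1 : v <= -1 by nia.
    have : u * q i.+1 + v * q i.+2 <= - q i.+2 by nia.
    lia.
  have v1 : 1 <= v by nia.
  have : q i.+2 <= u * q i.+1 + v * q i.+2 by nia.
  lia.
rewrite formE [e i.+1]cf_errE.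
have -> : u%:~R * (- x i.+1 * e i.+2) + v%:~R * e i.+2 =
  - ((u%:~R * x i.+1 - v%:~R) * e i.+2) by ring.
rewrite normrN !normrM normrN ler_wpM2r//.
have u1 : u <= -1 \/ 1 <= u by lia.
have [{}u1|{}u1] := u1.
- have v0 : 0 <= v by nia.
  have : u%:~R <= (-1)%:~R :> R by rewrite ler_int.
  have : 0%:~R <= v%:~R :> R by rewrite ler_int.
  rewrite (gtr0_norm x1) => v0' u1'; rewrite ler_normr; apply/orP; right; nra.
- have v0 : v <= 0 by nia.
  have : 1%:~R <= u%:~R :> R by rewrite ler_int.
  have : v%:~R <= 0%:~R :> R by rewrite ler_int.
  rewrite (gtr0_norm x1) => v0' u1'; rewrite ler_normr; apply/orP; left; nra.
Qed.

Lemma cf_den_bracket (Q : R) : 1 <= Q ->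
  exists i, (q i.+2)%:~R <= Q < (q i.+3)%:~R.
Proof.
move=> Q1.
have [|k kQ kmin] := @ex_minnP (fun i => Q < (q i.+2)%:~R).
  exists (Num.bound Q).
  rewrite (lt_le_trans (archi_boundP _)) ?(le_trans ler01)//.
  by rewrite pmulrn ler_int cf_den_ge.
case: k => [|k] in kQ kmin *; last first.
  by exists k; rewrite kQ leNgt andbT; apply/negP => /kmin; rewrite ltnn.
by move: kQ; rewrite cf_denSS /= mulr0 add0r ltNge Q1.
Qed.
End Convergents.

(** * Plane lattices and disks *)

Lemma diskP (R : realType) (z p : R * R) (r : R) : 0 < r ->
  disk z r p <-> (p.1 - z.1) ^+ 2 + (p.2 - z.2) ^+ 2 < r ^+ 2.
Proof.
move=> r0; rewrite /disk /= -{1}(gtr0_norm r0) -sqrtr_sqr.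
by rewrite ltr_sqrt// exprn_gt0.
Qed.

Lemma card_leI1P (T : Type) (A : set T) : (A #<= `I_1)%card <-> is_subset1 A.
Proof.
split=> [/pcard_leP[f] u v Au Av|A1].
  have f0 y : A y -> f y = 0%N by move=> /(@funS _ _ _ _ f) /=; case: (f y).
  by apply: (@inj _ _ _ f); rewrite ?in_setE//; exact: etrans (f0 u Au) (esym (f0 v Av)).
have [->|/set0P[y Ay]] := eqVneq A set0; first exact: card_ge0.
rewrite -(card_le_eqr (@card_set1 _ y)); apply: subset_card_le => u Au /=.
exact: A1.
Qed.

(** Expand [z] in the basis and round both coordinates down: the remainder lies
    in the parallelogram spanned by the basis. *)
Lemma lattice_rounding (R : realType) (a1 b1 a2 b2 z1 z2 : R) :
  a1 * b2 - a2 * b1 != 0 ->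
  exists u v : int,
    `|u%:~R * a1 + v%:~R * a2 - z1| <= `|a1| + `|a2| /\
    `|u%:~R * b1 + v%:~R * b2 - z2| <= `|b1| + `|b2|.
Proof.
move=> det0.
pose al := (z1 * b2 - z2 * a2) / (a1 * b2 - a2 * b1).
pose be := (z2 * a1 - z1 * b1) / (a1 * b2 - a2 * b1).
have z1E : z1 = al * a1 + be * a2 by rewrite /al /be; field.
have z2E : z2 = al * b1 + be * b2 by rewrite /al /be; field.
have frac (y : R) : `|(Num.floor y)%:~R - y| <= 1.
  have := floor_itv y; rewrite intrD => /andP[h1 h2].
  rewrite ler_norml; lra.
have round (c d : R) :
    `|(Num.floor al)%:~R * c + (Num.floor be)%:~R * d - (al * c + be * d)|
      <= `|c| + `|d|.
  have -> : (Num.floor al)%:~R * c + (Num.floor be)%:~R * d - (al * c + be * d)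
    = ((Num.floor al)%:~R - al) * c + ((Num.floor be)%:~R - be) * d by ring.
  rewrite (le_trans (ler_normD _ _))// !normrM.
  by rewrite lerD// -[leRHS]mul1r ler_wpM2r.
by exists (Num.floor al), (Num.floor be); rewrite {1}z1E {1}z2E.
Qed.

Lemma norm_det_le (R : realType) (a b c d : R) :
  (a * d - b * c) ^+ 2 <= (a ^+ 2 + b ^+ 2) * (c ^+ 2 + d ^+ 2).
Proof.
rewrite -subr_ge0 [X in 0 <= X](_ : _ = (a * c + b * d) ^+ 2) ?sqr_ge0//.
by ring.
Qed.

(** * Lower bounds for products and for short vectors *)

Definition diophantine_gap (R : realType) (theta : R) : Prop :=
  exists2 c : R, 0 < c &
    forall m n : int, m != 0 -> c <= `|m%:~R| * `|m%:~R * theta - n%:~R|.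

(** Nonzero vectors with [m = 0] are multiples of [(sqrt t, 0)], whose length is at least
    1 anyway. *)
Definition short_vector_gap (R : realType) (theta : R) : Prop :=
  exists2 s : R, 0 < s &
    forall t, 1 <= t -> forall m n : int, m != 0 ->
    s <= ((m%:~R * theta - n%:~R) * Num.sqrt t) ^+ 2 + (m%:~R / Num.sqrt t) ^+ 2.

Section Gaps.
Context {R : realType} (theta : R).
Local Notation L := (Lambda theta).
Local Notation T := [set t : R | 1 <= t].

Lemma norm_intr_ge1 (m : int) : m != 0 -> 1 <= `|m%:~R| :> R.
Proof. by move=> m0; rewrite -intr_norm (ler_int R 1); lia. Qed.

(** The origin is a lattice point, so a lattice vector shorter than [s] would be
    a second point of the disk of radius [s] about it. *)
Lemma uniformly_discrete_short_vector_gap :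
  uniformly_discrete T L -> short_vector_gap theta.
Proof.
case=> s s0 udL; exists (s ^+ 2); first by rewrite exprn_gt0.
move=> t t1 m n m0; rewrite leNgt; apply/negP => small.
have t0 : 0 < Num.sqrt t by rewrite sqrtr_gt0 (lt_le_trans ltr01).
have /card_leI1P sub := udL t t1 (0, 0).
have [] : (0, 0) = ((m%:~R * theta - n%:~R) * Num.sqrt t, m%:~R / Num.sqrt t).
  apply: sub; (split; first apply/diskP => //=).
  - by rewrite subrr expr0n addr0 exprn_gt0.
  - by exists 0, 0; rewrite !mul0r subrr mul0r.
  - by rewrite !subr0.
  - by exists m, n.
move=> _ /esym/eqP; rewrite mulf_eq0 invr_eq0 (gt_eqF t0) orbF intr_eq0.
by rewrite (negPf m0).
Qed.

(** The determinant of [v = (a, b)] with any lattice point is an integer.  At the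
    centre [z = (- b, a) / (2 |v|^2)] the determinant with [v] is [1/2], hence
    for a lattice point [y] in the disk about [z] the determinant of [v] and
    [y - z] is at least [1/2] in absolute value; it is at most [|v| r]. *)
Lemma relatively_dense_short_vector_gap :
  relatively_dense T L -> short_vector_gap theta.
Proof.
case=> r r0 rdL; exists ((2 * r) ^- 2); first by rewrite invr_gt0 exprn_gt0 ?mulr_gt0.
move=> t t1 m n m0.
set w := Num.sqrt t.
have w0 : 0 < w by rewrite sqrtr_gt0 (lt_le_trans ltr01).
set a := _ * w; set b := _ / w; set N := a ^+ 2 + b ^+ 2.
have N0 : 0 < N.
  by rewrite ltr_wpDl ?sqr_ge0// exprn_even_gt0//= mulf_neq0 ?intr_eq0// invr_neq0 ?gt_eqF.
have [[c d] [/diskP /= disk_cd [m' [n' [cE dE]]]]] := rdL t t1 (- b / (2 * N), a / (2 * N)).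
pose k := m * n' - m' * n.
have detE : a * (d - a / (2 * N)) - b * (c - - b / (2 * N)) = k%:~R - 2^-1.
  have -> : a * (d - a / (2 * N)) - b * (c - - b / (2 * N)) = (a * d - b * c) - N / (2 * N).
    by rewrite /N; field; rewrite gt_eqF.
  rewrite invfM mulrCA mulfV ?gt_eqF// mulr1; congr (_ - _).
  rewrite /k intrB !intrM cE dE /a /b -/w; field; by rewrite gt_eqF.
have det_ge : 4^-1 <= (k%:~R - 2^-1) ^+ 2 :> R.
  have [k0|k1] : k <= 0 \/ 1 <= k by lia.
    have : k%:~R <= 0%:~R :> R by rewrite ler_int.
    nra.
  have : 1%:~R <= k%:~R :> R by rewrite ler_int.
  nra.
have := norm_det_le a b (c - - b / (2 * N)) (d - a / (2 * N)).
rewrite detE -/N => /(le_trans det_ge) lower.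
rewrite -[_ ^-1]mul1r ler_pdivrMr ?exprn_gt0 ?mulr_gt0//.
have := disk_cd r0.
set X := _ + _ in lower * => Xr.
have : N * X <= N * r ^+ 2 by rewrite ler_wpM2l// ltW.
rewrite exprMn; lra.
Qed.

Hypothesis irr_theta : irrational theta.

(** At [t = |m| / |m theta - n|] the squared length of the vector is twice the
    product to be bounded.  This [t] is admissible unless
    [|m theta - n| > |m|], and then the product is at least 1. *)
Lemma short_vector_diophantine_gap :
  short_vector_gap theta -> diophantine_gap theta.
Proof.
case=> s s0 gap; exists (Num.min (s / 2) 1); first by rewrite lt_min ltr01 divr_gt0.
move=> m n m0; rewrite ge_min.
have B1 := norm_intr_ge1 m0.
set A := `|_ - _|; set B := `|_|%R in B1 *.
have A0 : 0 < A.
  rewrite normr_gt0 subr_eq0; apply/eqP => mn; apply: irr_theta.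
  exists (n%:~R / m%:~R) => //=.
  by rewrite fmorph_div /= !ratr_int -mn mulrC mulKf ?intr_eq0.
(* A is the error and B the denominator; they are compared to decide whether
   t = B / A is at least 1. *)
have [BA|AB] := ltP B A; first by apply/orP; right; nra.
have /gap/(_ m n m0) : 1 <= B / A by rewrite ler_pdivlMr// mul1r.
rewrite exprMn expr_div_n sqr_sqrtr ?divr_ge0 ?(ltW A0) ?(le_trans ler01)//.
rewrite -[X in X * _]real_normK ?num_real// -/A.
rewrite -[X in _ + X / _]real_normK ?num_real// -/B.
have -> : A ^+ 2 * (B / A) + B ^+ 2 / (B / A) = 2 * (B * A).
  by field; rewrite !gt_eqF// (lt_le_trans ltr01).
by move=> h; apply/orP; left; lra.
Qed.

(** A nonzero difference of lattice points with [m != 0] has coordinates whose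
    product is at least [c] in absolute value, so its squared length is at least
    [2 c]; with [m = 0] it has length at least [sqrt t >= 1]. *)
Lemma diophantine_gap_uniformly_discrete :
  diophantine_gap theta -> uniformly_discrete T L.
Proof.
case=> c c0 gap.
pose k := Num.min c 1.
have k0 : 0 < k by rewrite lt_min c0 ltr01.
have kc : k <= c by rewrite ge_min lexx.
have k1 : k <= 1 by rewrite ge_min lexx orbT.
pose s := k / 2; have s0 : 0 < s by rewrite divr_gt0.
exists s => // t t1 z; apply/card_leI1P.
move=> v v' [/(diskP _ _ s0) close [m [n vE]]] [/(diskP _ _ s0) close' [m' [n' vE']]].
move: close close'; rewrite {v}vE {v'}vE'.
rewrite /=; set w := Num.sqrt t.
have w1 : 1 <= w by rewrite -sqrtr1 ler_sqrt// (le_trans ler01).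
set a := _ * w; set b := _ / w; set a' := (_ * _ - _) * w; set b' := m'%:~R / w.
move=> close close'.
(* Two points of a disk of radius k / 2 are at distance less than k, by the
   parallelogram law. *)
have near : (a - a') ^+ 2 + (b - b') ^+ 2 < k ^+ 2.
  have : 0 <= ((a - z.1) + (a' - z.1)) ^+ 2 + ((b - z.2) + (b' - z.2)) ^+ 2.
    by rewrite addr_ge0 ?sqr_ge0.
  have sE : s ^+ 2 = k ^+ 2 / 4 by rewrite /s; field.
  rewrite sE in close close'; lra.
have w0 : 0 < w by rewrite (lt_le_trans ltr01).
have aE : a - a' = ((m - m')%:~R * theta - (n - n')%:~R) * w by rewrite /a /a' !intrB; ring.
have bE : b - b' = (m - m')%:~R / w by rewrite /b /b' !intrB; ring.
have [mm|mm] := eqVneq (m - m') 0; last first.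
  have := gap _ (n - n') mm; rewrite -normrM => gapmn; exfalso.
  have prod : (m - m')%:~R * ((m - m')%:~R * theta - (n - n')%:~R) = (a - a') * (b - b').
    by rewrite aE bE; field; rewrite gt_eqF.
  rewrite prod ler_normr in gapmn.
  have k2 : k ^+ 2 <= k by nra.
  have h1 : 0 <= (a - a' + (b - b')) ^+ 2 := sqr_ge0 _.
  have h2 : 0 <= (a - a' - (b - b')) ^+ 2 := sqr_ge0 _.
  by case/orP: gapmn => ?; nra.
have [nn|nn] := eqVneq (n - n') 0.
  by congr pair; apply/eqP; rewrite -subr_eq0 ?aE ?bE mm ?nn !mul0r ?subr0 ?mul0r.
exfalso; move: near; rewrite aE bE mm mul0r mul0r sub0r expr0n /= addr0 mulNr sqrrN.
have y1 : 1 <= (n - n')%:~R ^+ 2 :> R.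
  by rewrite -real_normK ?num_real// exprn_ege1// norm_intr_ge1.
rewrite exprMn; have : 1 <= w ^+ 2 by rewrite exprn_ege1.
nra.
Qed.

(** As [q_i |q_i theta - p_i| <= 1 / a_(i+1)], the gap bounds [a_(i+1)].  The quotient [a_0] is not controlled by the gap and enters the
    bound separately. *)
Lemma diophantine_gap_badly_approximable :
  diophantine_gap theta -> badly_approximable theta.
Proof.
case=> c c0 gap; split=> //.
have boundS i : partial_quotient theta i.+1 <= Num.floor c^-1.
  rewrite floor_ge_int.
  have den0 : cf_den theta i.+2 != 0 by rewrite gt_eqF// cf_den_gt0.
  have den_ge : 0 < (cf_den theta i.+2)%:~R :> R by rewrite ltr0z cf_den_gt0.
  have := gap _ (cf_num theta i.+2) den0.
  rewrite -/(cf_err theta i.+2) (gtr0_norm den_ge).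
  have := cf_den_err_upper irr_theta i.
  rewrite cf_denSS intrD intrM.
  set A := (partial_quotient _ _)%:~R; set E := `|_|; set Q := (cf_den _ i.+2)%:~R.
  have : 0 <= (cf_den theta i.+1)%:~R :> R by rewrite ler0z cf_den_ge0.
  have A1 : 1 <= A by rewrite (ler_int R 1) partial_quotientS_ge1.
  have E0 : 0 <= E := normr_ge0 _.
  move=> q0 up low; rewrite -[leRHS]mul1r ler_pdivlMr//.
  have : A * c <= A * (Q * E) by rewrite ler_wpM2l// (le_trans ler01).
  have : 0 <= (cf_den theta i.+1)%:~R * E by rewrite mulr_ge0.
  lra.
exists (Num.max `|partial_quotient theta 0| (Num.floor c^-1)) => -[|i].
  by rewrite le_max lexx.
rewrite le_max; apply/orP; right; rewrite ger0_norm ?boundS//.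
exact: le_trans (partial_quotientS_ge1 irr_theta i).
Qed.

(** Replace [(m, n)] by the convergent with the largest denominator not
    exceeding [|m|]: neither factor of the product increases. *)
Lemma badly_approximable_diophantine_gap :
  badly_approximable theta -> diophantine_gap theta.
Proof.
case=> _ [M aM].
have M1 : 1 <= M.
  exact: le_trans (partial_quotientS_ge1 irr_theta 0) (le_trans (ler_norm _) (aM 1%N)).
have M0 : 0 < M%:~R + 2 :> R by rewrite addr_gt0// ltr0z; lia.
exists (M%:~R + 2)^-1 => [|m n m0]; first by rewrite invr_gt0.
have [i /andP[lo hi]] := cf_den_bracket irr_theta (norm_intr_ge1 m0).
have aMi : (partial_quotient theta i.+1)%:~R <= M%:~R :> R.
  by rewrite ler_int (le_trans (ler_norm _)).
rewrite -[_^-1]mul1r ler_pdivrMr// mulrC.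
apply: le_trans (cf_den_err_lower irr_theta aMi) _.
rewrite ler_wpM2l ?(ltW M0)// ler_pM//.
  by rewrite ler0z cf_den_ge0.
apply: cf_err_best => //.
by rewrite -(ltr_int R) intr_norm.
Qed.

(** The denominators [q2 <= sqrt t < q3] of consecutive convergents satisfy
    [q3 <= (M + 1) q2], and both errors are at most [1 / q3]; hence the basis
    vectors they define have coordinates bounded by [1], [1] and [1], [M + 1]. *)
Lemma badly_approximable_relatively_dense :
  badly_approximable theta -> relatively_dense T L.
Proof.
case=> _ [M aM].
have M1 : 1 <= M%:~R :> R.
  rewrite (ler_int R 1).
  exact: le_trans (partial_quotientS_ge1 irr_theta 0) (le_trans (ler_norm _) (aM 1%N)).
(* Rounding moves the coordinates by at most 1 + 1 and 1 + (M + 1), and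
   2^2 + (M + 2)^2 < (M + 5)^2. *)
pose r : R := M%:~R + 5.
have r0 : 0 < r by rewrite /r; lra.
exists r => // t t1 z; set w := Num.sqrt t.
have w1 : 1 <= w by rewrite -sqrtr1 ler_sqrt// (le_trans ler01).
have w0 : 0 < w by rewrite (lt_le_trans ltr01).
have [i /andP[lo hi]] := cf_den_bracket irr_theta w1.
set q2 := (cf_den theta i.+2)%:~R in lo; set q3 := (cf_den theta i.+3)%:~R in hi.
have q20 : 0 < q2 by rewrite ltr0z cf_den_gt0.
have q30 : 0 < q3 by rewrite ltr0z cf_den_gt0.
have up : q3 * `|cf_err theta i.+2| <= 1 := cf_den_err_upper irr_theta i.
have e32 : `|cf_err theta i.+3| <= `|cf_err theta i.+2|.
  rewrite [cf_err theta i.+2]cf_errE// normrM normrN ler_peMl//.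
  by rewrite ler_normr ltW// complete_quotientS_gt1.
have q32 : q3 <= (M%:~R + 1) * q2.
  rewrite /q3 cf_denSS intrD intrM mulrDl mul1r lerD//.
    by rewrite ler_wpM2r ?(ltW q20)// ler_int (le_trans (ler_norm _)).
  by rewrite ler_int cf_den_homo.
have e2w : `|cf_err theta i.+2 * w| <= 1.
  rewrite normrM (gtr0_norm w0) mulrC (le_trans _ up)// ler_wpM2r//; exact: ltW.
have e3w : `|cf_err theta i.+3 * w| <= 1.
  by rewrite normrM (le_trans _ e2w)// normrM ler_wpM2r.
have q2w : `|q2 / w| <= 1 by rewrite gtr0_norm ?divr_gt0// ler_pdivrMr// mul1r.
have q3w : `|q3 / w| <= M%:~R + 1.
  rewrite gtr0_norm ?divr_gt0// ler_pdivrMr// (le_trans q32)// ler_wpM2l//.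
  by rewrite addr_ge0// (le_trans ler01).
have det0 : cf_err theta i.+2 * w * (q3 / w) - cf_err theta i.+3 * w * (q2 / w) != 0.
  rewrite (_ : _ - _ = (-1) ^+ i.+2) ?signr_eq0// -(cf_det theta) -/q2 -/q3.
  by field; rewrite gt_eqF.
have [u [v [ux uy]]] := lattice_rounding z.1 z.2 det0.
pose m := u * cf_den theta i.+2 + v * cf_den theta i.+3.
pose n := u * cf_num theta i.+2 + v * cf_num theta i.+3.
exists ((m%:~R * theta - n%:~R) * w, m%:~R / w); split; last by exists m, n.
have mE : m%:~R / w = u%:~R * (q2 / w) + v%:~R * (q3 / w).
  by rewrite /m intrD 2!intrM -/q2 -/q3; ring.
have eE : (m%:~R * theta - n%:~R) * w =
    u%:~R * (cf_err theta i.+2 * w) + v%:~R * (cf_err theta i.+3 * w).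
  by rewrite /m /n 2!intrD 4!intrM /cf_err; ring.
apply/diskP => //=; rewrite mE eE.
have {}ux := le_trans ux (lerD e2w e3w).
have {}uy := le_trans uy (lerD q2w q3w).
rewrite -[X in X + _]real_normK ?num_real// -[X in _ + X]real_normK ?num_real//.
apply: le_lt_trans (lerD (lerXn2r 2 _ _ ux) (lerXn2r 2 _ _ uy)) _; rewrite ?nnegrE//; try lra.
by rewrite /r; nra.
Qed.
End Gaps.

(** * The equivalence *)

Theorem proposition5 (R : realType) (theta : R) (irr_theta : irrational theta) :
  (relatively_dense [set t : R | 1 <= t] (Lambda theta)
     <-> uniformly_discrete [set t : R | 1 <= t] (Lambda theta)) /\
  (uniformly_discrete [set t : R | 1 <= t] (Lambda theta)
     <-> badly_approximable theta).
Proof.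
have gap_bad : short_vector_gap theta -> badly_approximable theta.
  move=> /(short_vector_diophantine_gap irr_theta).
  exact: diophantine_gap_badly_approximable.
have bad_ud : badly_approximable theta ->
    uniformly_discrete [set t : R | 1 <= t] (Lambda theta).
  move=> /(badly_approximable_diophantine_gap irr_theta).
  exact: diophantine_gap_uniformly_discrete.
split; split.
- by move=> /relatively_dense_short_vector_gap /gap_bad /bad_ud.
- move=> /uniformly_discrete_short_vector_gap /gap_bad.
  exact: badly_approximable_relatively_dense.
- by move=> /uniformly_discrete_short_vector_gap /gap_bad.
- exact: bad_ud.
Qed.
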